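(* The set $Z$ satisfies $$Z=\left\{x\in\mathbb{R}^n:\ \exists\,\gamma\ge 0 \text{ such that } \delta-\epsilon\gamma\le \frac1N\sum_{j\in[N]}\min\left\{f(x,\zeta^j)-\gamma,\,0\right\}\right\},$$ where $$f(x,\zeta)=\min\left\{\min_{i\in[I]\setminus\mathcal{I}(x)}\frac{\max\{b_i(x)-a(x)^\top\zeta_i,\,0\}}{\|a(x)\|_*},\ \min_{i\in\mathcal{I}(x)}\chi_{\{x:\,b_i(x)<0\}}(x)\right\},$$ with $\mathcal{I}(x)=\emptyset$ if $a(x)\neq 0$ and $\mathcal{I}(x)=[I]$ otherwise, and $\chi_R(x)=\infty$ if $x\notin R$ and $\chi_R(x)=0$ if $x\in R$.
   Context: Let $n,I,N$ be positive integers, $[R]:=\{1,\dots,R\}$, $\epsilon\in(0,1)$, $\delta>0$. Let $\eta_1,\eta_2\in\{0,1\}$ with $\eta_1+\eta_2\ge1$. For $x\in\mathbb{R}^n$ let $a(x)=\begin{pmatrix}\eta_1x\\ \eta_2\end{pmatrix}\in\mathbb{R}^{n+1}$ and, for $i\in[I]$, $b_i(x)=B_i^\top x+b^i$ with given $B_i\in\mathbb{R}^n$, $b^i\in\mathbb{R}$. The uncertain parameter $\xi=(\xi_1,\dots,\xi_I)$, $\xi_i\in\mathbb{R}^{n+1}$, takes values in $\Xi=\mathbb{R}^{I\times(n+1)}$, equipped with a norm $\|\cdot\|$. For $a\in\mathbb{R}^{n+1}$ the dual norm is $\|a\|_*=\sup\{a^\top u_i:\ u=(u_1,\dots,u_I)\in\Xi,\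 \|u\|\le1\}$, where the norm is such that this value does not depend on $i\in[I]$ (as for any $L_p$ norm). Samples $\zeta^1,\dots,\zeta^N\in\Xi$, $\zeta^j=(\zeta^j_1,\dots,\zeta^j_I)$, are given (realizations of i.i.d. samples from a true distribution); the empirical distribution $\mathbb{P}_{\tilde\zeta}$ gives mass $1/N$ to each $\zeta^j$, $j\in[N]$. The Wasserstein distance of probability distributions on $\Xi$ is $$W(\mathbb{P}_1,\mathbb{P}_2)=\inf\left\{\int_{\Xi\times\Xi}\|\xi_1-\xi_2\|\,\mathbb{Q}(d\xi_1,d\xi_2):\ \mathbb{Q}\text{ a joint distribution with marginals }\mathbb{P}_1,\mathbb{P}_2\right\},$$ and the ambiguity set is $\mathcal{P}=\{\mathbb{P}:\ \mathbb{P}\{\tilde\xi\in\Xi\}=1,\ W(\mathbb{P},\mathbb{P}_{\tilde\zeta})\le\delta\}$. Define $$Z=\left\{x\in\mathbb{R}^n:\ \inf_{\mathbb{P}\in\mathcal{P}}\mathbb{P}\left\{\tilde\xi:\ a(x)^\top\tilde\xi_i\le b_i(x),\ \forall i\in[I]\right\}\ge1-\epsilon\right\}.$$ Conventions: a minimum over the empty set is $+\infty$; $f$ takes values in $[0,+\infty]$. *)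

(* Defs.v *)
From HB Require Import structures.
From mathcomp Require Import all_boot all_order all_algebra.
From mathcomp Require Import all_classical all_reals all_analysis.

Set Implicit Arguments.
Unset Strict Implicit.
Unset Printing Implicit Defensive.

Import Order.TTheory GRing.Theory Num.Theory.
Import numFieldNormedType.Exports.

Local Open Scope classical_set_scope.
Local Open Scope ring_scope.

(* R^(I x (n+1)) with its Borel sigma-algebra. The open sets are those of the
   product topology, hence also those of any norm on this space. *)
Notation Xi R I n := (g_sigma_algebraType (@open 'M[R]_(I, n + 1))).

Definition is_norm (R : realType) (I m : nat) (nrm : 'M[R]_(I, m) -> R) :=
  [/\ forall u v, nrm (u + v) <= nrm u + nrm v,
      forall (c : R) u, nrm (c *: u) = `|c| * nrm u
    & forall u, nrm u = 0 -> u = 0].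

(* [(u *m a) i 0] is the inner product of a with the i-th row of u. The value
   of the supremum is required to be the same for every i. *)
Definition is_dual_norm (R : realType) (I m : nat)
    (nrm : 'M[R]_(I, m) -> R) (dnrm : 'cV[R]_m -> R) :=
  forall (i : 'I_I) (a : 'cV[R]_m),
    dnrm a = sup [set (u *m a) i 0 | u in [set u | nrm u <= 1]].

Definition avec (R : realType) (n : nat) (eta1 eta2 : bool) (x : 'cV[R]_n) :
    'cV[R]_(n + 1) :=
  col_mx (eta1%:R *: x) (eta2%:R)%:M.

Definition bfun (R : realType) (n I : nat) (B : 'I_I -> 'cV[R]_n)
    (b : 'I_I -> R) (i : 'I_I) (x : 'cV[R]_n) : R :=
  ((B i)^T *m x) 0 0 + b i.

Section empirical.
Context {R : realType} {I n N : nat}.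
Local Open Scope ereal_scope.

Definition empirical (hN : (0 < N)%N) (zeta : 'I_N -> Xi R I n)
    (A : set (Xi R I n)) : \bar R :=
  (N%:R^-1)%:E * \sum_(j < N) \d_(zeta j) A.

Variables (hN : (0 < N)%N) (zeta : 'I_N -> Xi R I n).

Let diracs (k : nat) : {measure set (Xi R I n) -> \bar R} :=
  if insub k is Some j then \d_(zeta j) else mzero.

Let invN_ge0 : (0 <= N%:R^-1 :> R)%R.
Proof. by rewrite invr_ge0. Qed.

Let empiricalE :
  empirical hN zeta = mscale (NngNum invN_ge0) (msum diracs N).
Proof.
apply/funext => A; rewrite /empirical /mscale /msum; congr (_ * _).
by apply: eq_bigr => j _; rewrite /diracs valK.
Qed.

Let empirical0 : empirical hN zeta set0 = 0.
Proof. by rewrite empiricalE measure0. Qed.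

Let empirical_ge0 A : 0 <= empirical hN zeta A.
Proof. by rewrite empiricalE measure_ge0. Qed.

Let empirical_sigma_additive : semi_sigma_additive (empirical hN zeta).
Proof. by rewrite empiricalE; exact: measure_semi_sigma_additive. Qed.

HB.instance Definition _ := isMeasure.Build _ _ _ (empirical hN zeta)
  empirical0 empirical_ge0 empirical_sigma_additive.

Let empirical_setT : empirical hN zeta setT = 1.
Proof.
rewrite /empirical (eq_bigr (fun=> 1)); last by move=> j _; rewrite diracT.
rewrite sumEFin big_const_ord iter_addr_0 -EFinM mulVf//.
by rewrite pnatr_eq0 -lt0n.
Qed.

HB.instance Definition _ :=
  Measure_isProbability.Build _ _ _ (empirical hN zeta) empirical_setT.

End empirical.

Section ambiguity.
Context {R : realType} {I n : nat}.
Implicit Types P : probability (Xi R I n) R.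
Local Open Scope ereal_scope.

Definition couplings P1 P2 : set (probability (Xi R I n * Xi R I n)%type R) :=
  [set Q | forall A : set (Xi R I n), measurable A ->
     Q (A `*` setT) = P1 A /\ Q (setT `*` A) = P2 A].

Definition wasserstein (nrm : 'M[R]_(I, n + 1) -> R) P1 P2 : \bar R :=
  ereal_inf [set \int[Q]_z (nrm ((z.1 : 'M[R]_(I, n + 1)) - z.2)%R)%:E
            | Q in couplings P1 P2].

Definition ambiguity (nrm : 'M[R]_(I, n + 1) -> R) (delta : R) P0 :
    set (probability (Xi R I n) R) :=
  [set P | wasserstein nrm P P0 <= delta%:E].

Definition safety_set (eta1 eta2 : bool) (B : 'I_I -> 'cV[R]_n) (b : 'I_I -> R)
    (x : 'cV[R]_n) : set (Xi R I n) :=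
  [set xi | forall i, (((xi : 'M[R]_(I, n + 1)) *m avec eta1 eta2 x) i 0
                       <= bfun B b i x)%R].

Definition Zset (eta1 eta2 : bool) (B : 'I_I -> 'cV[R]_n) (b : 'I_I -> R)
    (nrm : 'M[R]_(I, n + 1) -> R) (eps delta : R) P0 : set 'cV[R]_n :=
  [set x | (1 - eps)%:E <=
     ereal_inf [set P (safety_set eta1 eta2 B b x)
               | P in ambiguity nrm delta P0]].

Definition chi (T : Type) (S : set T) (x : T) : \bar R :=
  if x \in S then 0 else +oo.

Definition Iset (eta1 eta2 : bool) (x : 'cV[R]_n) : {set 'I_I} :=
  if avec eta1 eta2 x == 0%R then [set: 'I_I]%SET else finset.set0.

Definition fdist (eta1 eta2 : bool) (B : 'I_I -> 'cV[R]_n) (b : 'I_I -> R)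
    (dnrm : 'cV[R]_(n + 1) -> R) (x : 'cV[R]_n) (zeta : 'M[R]_(I, n + 1)) :
    \bar R :=
  mine
    (\big[mine/+oo]_(i in ~: Iset eta1 eta2 x)
       ((Num.max (bfun B b i x - (zeta *m avec eta1 eta2 x) i 0) 0
        / dnrm (avec eta1 eta2 x))%R)%:E)
    (\big[mine/+oo]_(i in Iset eta1 eta2 x)
       chi [set y | (bfun B b i y < 0)%R] x).

End ambiguity.

(* Main.v *)
Require Import Defs.
From HB Require Import structures.
From mathcomp Require Import all_boot all_order all_algebra.
From mathcomp Require Import all_classical all_reals all_analysis.
From mathcomp Require Import measurable_realfun.
From mathcomp Require Import ring lra.

Set Implicit Arguments.
Unset Strict Implicit.
Unset Printing Implicit Defensive.

Import Order.TTheory GRing.Theory Num.Theory.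
Import numFieldNormedType.Exports.

Local Open Scope classical_set_scope.
Local Open Scope ring_scope.

(** Write [U] for the open set of parameters that violate some constraint. As
    long as [U] is nonempty, [f(x, z)] is the distance from [z] to [U]: for
    [a(x) != 0] because [U] is a union of half-spaces, whose distances are
    computed with the dual norm, and for [a(x) = 0] because then [U] is the
    whole space. If [U] is empty then [f(x, .) = +oo] and both sides of the
    equivalence hold, the right one with [gamma = delta / eps]. So everything
    rests on one statement about the distance [d] to a measurable set [U]
    ([ambiguity_probability_le]): all [P] in the Wasserstein ball satisfy
    [P U <= eps] iff some [gamma >= 0] satisfies
    [delta - eps * gamma <= avg_j min (d (zeta j) - gamma) 0].

    - If such a [gamma] exists, integrate the pointwise inequality
      [gamma * 1_U u <= |u - z| + max (gamma - d z) 0] against an arbitrary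
      coupling of [P] with the empirical distribution, and take the infimum
      over couplings ([ambiguity_upper_bound]). Since [delta > 0], the
      condition excludes [gamma = 0], so one may divide by [gamma].

    - Conversely, moving a fraction [t j] of the mass at [zeta j] to a point of
      [U] at distance almost [d (zeta j)] produces an element of the ball as
      soon as [avg_j t j * d (zeta j) < delta] ([ambiguity_attains]). Hence no
      such [t] has average above [eps]: a continuous knapsack problem has a
      small optimum, and its greedy solution, which fills the items in
      increasing order of [d], exhibits [gamma] as the [eps]-quantile of the
      numbers [d (zeta j)] ([fractional_knapsack]).

    The given norm is arbitrary, so that two facts are needed about it. It is
    equivalent to the sup norm, which makes the supremum in the dual norm finite
    ([sup_le_is_norm]), and the transport cost is measurable for the product of
    the Borel sigma-algebras ([measurable_is_norm_sub]). *)

(** * Norms on a space of matrices *)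

Section norm_theory.
Context {R : realType} {I m : nat} (nrm : 'M[R]_(I, m) -> R).
Hypothesis hnrm : is_norm nrm.

Lemma is_norm0 : nrm 0 = 0.
Proof. by case: hnrm => _ nZ _; rewrite -[0](scale0r 0) nZ normr0 mul0r. Qed.

Lemma is_normN u : nrm (- u) = nrm u.
Proof. by case: hnrm => _ nZ _; rewrite -scaleN1r nZ normrN1 mul1r. Qed.

Lemma is_normC u v : nrm (u - v) = nrm (v - u).
Proof. by rewrite -is_normN opprB. Qed.

Lemma is_norm_triangle u v w : nrm (u - w) <= nrm (u - v) + nrm (v - w).
Proof. by case: hnrm => nD _ _; rewrite -(subrKA v u) nD. Qed.

Lemma is_norm_ge0 u : 0 <= nrm u.
Proof.
case: hnrm => nD _ _; have := nD u (- u).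
by rewrite subrr is_norm0 is_normN -mulr2n pmulrn_lge0.
Qed.

Lemma is_norm_sum (J : finType) (F : J -> 'M[R]_(I, m)) :
  nrm (\sum_j F j) <= \sum_j nrm (F j).
Proof.
case: hnrm => nD _ _; elim/big_ind2 : _ => //; first by rewrite is_norm0.
by move=> x1 x2 y1 y2 h1 h2; exact: le_trans (nD _ _) (lerD h1 h2).
Qed.

Lemma is_norm_le_sup : exists2 K, 0 < K & forall u, nrm u <= K * `|u|.
Proof.
case: (hnrm) => nD nZ _.
exists (1 + \sum_i \sum_j nrm (delta_mx i j)).
  rewrite ltr_wpDr// sumr_ge0// => i _; rewrite sumr_ge0// => j _.
  exact: is_norm_ge0.
move=> u; rewrite {1}(matrix_sum_delta u).
apply: (le_trans (is_norm_sum _)).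
rewrite mulrDl mul1r ler_wpDl// mulr_suml ler_sum// => i _.
apply: (le_trans (is_norm_sum _)).
rewrite mulr_suml ler_sum// => j _.
rewrite nZ mulrC ler_wpM2l//; first exact: is_norm_ge0.
rewrite [leRHS]/Num.norm /= mx_normrE; apply/bigmax_geP; right => /=.
by exists (i, j).
Qed.

(** The one-sided inequality suffices, by exchanging [u] and [v]. *)
Lemma lipschitz_is_norm_continuous (f : 'M[R]_(I, m) -> R) :
  (forall u v, f u <= f v + nrm (u - v)) -> continuous f.
Proof.
move=> fl u; have [K K0 nK] := is_norm_le_sup.
apply/(@pseudometric_normed_Zmodule.cvgrPdist_lt _ _ _ (nbhs u)) => e e0.
apply/nbhs_ballP.
exists (e / K); first exact: divr_gt0.
move=> v; rewrite mx_norm_ball /ball_ /= => uv; suff: nrm (u - v) < e.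
  by have := fl u v; have := fl v u; rewrite (is_normC v) ltr_norml => *; lra.
by apply: (le_lt_trans (nK _)); rewrite mulrC -ltr_pdivlMr.
Qed.

Lemma is_norm_continuous : continuous nrm.
Proof.
apply: lipschitz_is_norm_continuous => u v.
by have := is_norm_triangle u v 0; rewrite !subr0 addrC.
Qed.

End norm_theory.

(** The continuous function [nrm] has a positive minimum on the compact unit
    sphere of the sup norm; flattening matrices to row vectors turns this into
    the Heine-Borel theorem. *)
Lemma sup_le_is_norm (R : realType) (I m : nat) (nrm : 'M[R]_(I, m) -> R) :
  is_norm nrm ->
  exists2 c : R, 0 < c & forall (u : 'M[R]_(I, m)) i j, c * `|u i j| <= nrm u.
Proof.
move=> hnrm; case: (hnrm) => nD nZ n0.
pose g (v : 'rV[R]_(I * m)) : R := nrm (vec_mx v).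
have gc : continuous g.
  apply: is_norm_continuous; rewrite /g; split.
  - move=> u v; rewrite linearD; exact: nD.
  - move=> k u; rewrite linearZ/=; exact: nZ.
  - by move=> u /n0 /(congr1 mxvec); rewrite vec_mxK linear0.
pose S := [set v : 'rV[R]_(I * m) | `|v| = 1].
have Sc : compact S.
  apply: bounded_closed_compact.
    exists 1; split=> [|y y1 v /= ->]; [exact: num_real|exact: ltW].
  have -> : S = Num.norm @^-1` [set 1] by [].
  apply: preimage_closed; last exact: closed_eq.
  by move=> v _; exact: (@norm_continuous R 'rV[R]_(I * m)).
have [c c0 cg] : exists2 c, 0 < c & forall v, S v -> c <= g v.
  (* The sphere is empty when the matrices have no entries. *)
  have [->|S0] := eqVneq S set0; first by exists 1.
  have [|w] := compact_EVT_min _ Sc (continuous_subspaceT gc); first exact/set0P.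
  rewrite inE => Sw gw; exists (g w); last by move=> v Sv; apply: gw; rewrite inE.
  rewrite lt0r (is_norm_ge0 hnrm) andbT; apply/eqP => /n0 w0.
  move: Sw; rewrite /S/= -(vec_mxK w) w0 linear0 normr0 => /eqP.
  by rewrite eq_sym oner_eq0.
exists c => // u i j.
have uij : `|u i j| <= `|mxvec u|.
  rewrite -mxvecE [leRHS]/Num.norm /= mx_normrE; apply/bigmax_geP; right => /=.
  by exists (0, mxvec_index i j).
apply: (@le_trans _ _ (c * `|mxvec u|)); first by rewrite ler_pM2l.
have [->|u0] := eqVneq (mxvec u) 0; first by rewrite normr0 mulr0 (is_norm_ge0 hnrm).
have u1 : 0 < `|mxvec u| by rewrite normr_gt0.
rewrite -ler_pdivlMr//.
have /cg : S (`|mxvec u|^-1 *: mxvec u).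
  by rewrite /S/= normrZ normfV normr_id mulVf// gt_eqF.
by rewrite /g linearZ/= mxvecK nZ normfV normr_id mulrC.
Qed.

(** * Measurability of the transport cost *)

Section measurability.
Context {R : realType} {I n : nat}.
Local Notation M := 'M[R]_(I, n + 1).
Variable nrm : M -> R.
Hypothesis hnrm : is_norm nrm.

Lemma continuous_measurable_Xi (f : M -> R) :
  continuous f -> measurable_fun setT (f : Xi R I n -> R).
Proof.
move=> /continuousP cf; apply: (measurability _ (RGenInftyO.measurableE R)) => //.
move=> _ [_ [a ->] <-]; rewrite setTI.
apply: sub_sigma_algebra; apply: cf; exact: interval_open.
Qed.

Lemma lipschitz_measurable (f : M -> R) :
  (forall u v, f u <= f v + nrm (u - v)) ->
  measurable_fun setT (f : Xi R I n -> R).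
Proof.
move=> fl; apply: continuous_measurable_Xi.
exact: (lipschitz_is_norm_continuous hnrm).
Qed.

Lemma is_norm_rat_approx (u : M) (e : R) : 0 < e ->
  exists q : 'M[rat]_(I, n + 1), nrm (u - map_mx ratr q) < e.
Proof.
move=> e0; have [K K0 nK] := is_norm_le_sup hnrm.
have eK : 0 < e / K / 2 by rewrite divr_gt0// divr_gt0.
have qx (x : R) : exists q : rat, `|x - ratr q| <= e / K / 2.
  have [|q] := @rat_in_itvoo R (x - e / K / 2) (x + e / K / 2); first by lra.
  rewrite in_itv/= => /andP[h1 h2]; exists q.
  by rewrite ler_norml; apply/andP; split; lra.
have /choice [q hq] : forall ij : 'I_I * 'I_(n + 1), exists q : rat,
  `|u ij.1 ij.2 - ratr q| <= e / K / 2 by move=> ij; exact: qx.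
exists (\matrix_(i, j) q (i, j)).
apply: (le_lt_trans (nK _)).
apply: (@le_lt_trans _ _ (K * (e / K / 2))).
  rewrite ler_pM2l// /Num.norm/= mx_normrE; apply/bigmax_leP; split; first exact: ltW.
  by move=> [i j] _; rewrite !mxE; exact: (hq (i, j)).
rewrite (_ : K * _ = e / 2); first by lra.
by field; rewrite gt_eqF.
Qed.

(** The product sigma-algebra is generated by rectangles, so that continuity
    alone does not give measurability. But [nrm (u - v) < r] holds iff
    [nrm (u - q) + nrm (v - q) < r] for some rational matrix [q], a countable
    union of conditions in which the two variables are separated. *)
Lemma measurable_is_norm_sub :
  measurable_fun setT
    (fun z : Xi R I n * Xi R I n => nrm ((z.1 : M) - z.2)).
Proof.
apply: (measurability _ (RGenInftyO.measurableE R)) => //.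
move=> _ [_ [r ->] <-]; rewrite setTI.
have -> : (fun z : Xi R I n * Xi R I n => nrm ((z.1 : M) - z.2)) @^-1` `]-oo, r[ =
  \bigcup_(q : 'M[rat]_(I, n + 1)) [set z : Xi R I n * Xi R I n |
     nrm ((z.1 : M) - map_mx ratr q) + nrm ((z.2 : M) - map_mx ratr q) < r].
  apply/seteqP; split=> [[u v]|[u v] [q _]]; rewrite /= in_itv/=.
    move=> uv.
    have [|q hq] := @is_norm_rat_approx u ((r - nrm (u - v)) / 2); first by lra.
    exists q => //=; have := is_norm_triangle hnrm v u (map_mx ratr q).
    by rewrite (is_normC hnrm v u); lra.
  apply: le_lt_trans; rewrite (is_normC hnrm v).
  exact: is_norm_triangle.
apply: countable_bigcupT_measurable => // q.
have mq : measurable_fun setT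
    (fun w : Xi R I n => nrm ((w : M) - map_mx ratr q)).
  apply: lipschitz_measurable => u v.
  by rewrite [leRHS]addrC; exact: is_norm_triangle.
have mD : measurable_fun setT (fun z : Xi R I n * Xi R I n =>
    nrm ((z.1 : M) - map_mx ratr q) + nrm ((z.2 : M) - map_mx ratr q)).
  apply: measurable_funD.
  - exact: (measurableT_comp mq measurable_fst).
  - exact: (measurableT_comp mq measurable_snd).
rewrite -[X in measurable X]setTI.
have := mD measurableT _ (@measurable_itv R `]-oo, r[).
by congr (measurable (_ `&` _)); apply/seteqP; split => z; rewrite /= in_itv.
Qed.

End measurability.

(** * Finite mixtures of Dirac measures *)

Section mixture.
Context d (T : measurableType d) (R : realType).

(** Both the worst-case distributions and their couplings with the empirical
    distribution have this form, and so has the empirical distribution. *)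
Lemma finite_mixture (J : finType) (w : J -> R) (p : J -> T) :
  (forall j, 0 <= w j) -> \sum_j w j = 1 ->
  exists P : probability T R,
    (forall A, P A = \sum_j (w j)%:E * \d_(p j) A)%E /\
    (forall f : T -> \bar R, measurable_fun setT f -> (forall x, 0 <= f x)%E ->
      \int[P]_x f x = \sum_j (w j)%:E * f (p j))%E.
Proof.
move=> w0 w1.
pose m (k : nat) : {measure set T -> \bar R} :=
  if insub k is Some i then
    mscale (NngNum (w0 (enum_val (i : 'I_#|J|)))) \d_(p (enum_val i))
  else mzero.
pose mu : {measure set T -> \bar R} := msum m #|J|.
have muE A : mu A = (\sum_j (w j)%:E * \d_(p j) A)%E.
  rewrite [LHS](_ : _ = (\sum_(k < #|J|) m k A)%E)//.
  rewrite [RHS](reindex (enum_val : 'I_#|J| -> J))/=; last first.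
    by apply: onW_bij; exact: enum_val_bij.
  by apply: eq_bigr => i _; rewrite /m valK.
have mu1 : mu setT = 1%E.
  rewrite muE -[1%E]/(1%R%:E) -w1 -sumEFin; apply: eq_bigr => j _.
  by rewrite diracT mule1.
pose P : probability T R :=
  HB.pack_for (probability T R) (msum m #|J|) (Measure_isProbability.Build _ _ _ mu mu1).
exists P; split; first exact: muE.
move=> f mf f0.
rewrite (@eq_measure_integral _ _ _ _ mu)//.
rewrite ge0_integral_measure_sum//.
rewrite [RHS](reindex (enum_val : 'I_#|J| -> J))/=; last first.
  by apply: onW_bij; exact: enum_val_bij.
apply: eq_bigr => i _; rewrite /m valK ge0_integral_mscale//.
by rewrite integral_dirac// diracT mul1e.
Qed.

End mixture.

(** * The continuous knapsack problem *)

Section knapsack.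
Context {R : realFieldType}.

(** Linear programming duality in closed form: [g], the marginal cost of raising
    the total at [E], is the least value [d k] such that more than [E] items
    have [d j <= d k]. The greedy solution takes the items with [d j < g] entirely
    and those with [d j = g] in the proportion [s] that brings the total to
    [E]. If [g] violated the inequality, this solution would leave some budget
    unused, and raising [s] slightly would give a total above [E]. *)
Lemma fractional_knapsack (N : nat) (d : 'I_N -> R) (E D : R) :
  (0 < N)%N -> (forall j, 0 <= d j) -> 0 <= E -> E < N%:R ->
  (forall t : 'I_N -> R, (forall j, 0 <= t j <= 1) ->
     \sum_j t j * d j < D -> \sum_j t j <= E) ->
  exists2 g, 0 <= g & D - E * g <= \sum_j Num.min (d j - g) 0.
Proof.
move=> N0 d0 E0 EN sol.
pose below (g : R) : R := \sum_j (d j < g)%R%:R.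
pose upto (g : R) : R := \sum_j (d j <= g)%R%:R.
have [k kP] : exists k, E < upto (d k).
  pose i0 := Ordinal N0.
  case: (@Order.TotalTheory.arg_maxP _ _ _ i0 xpredT d) => // k _ kmax.
  exists k; rewrite /upto (eq_bigr (fun=> 1)).
    by rewrite sumr_const card_ord.
  by move=> j _; have -> : d j <= d k by exact: kmax.
case: (@Order.TotalTheory.arg_minP _ _ _ k (fun k => E < upto (d k)) d) => // {kP}k.
set g := d k => Eg gmin.
have below_g : below g <= E.
  have [[i ig]|noi] := pselect (exists i, d i < g); last first.
    rewrite /below big1// => j _; case: ltP => // jg.
    by exfalso; apply: noi; exists j.
  case: (@Order.TotalTheory.arg_maxP _ _ _ i (fun i => d i < g) d) => // j jg jmax.
  (* [d j] is the largest value below [g], so [upto (d j)] counts the same items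
     as [below g] and the minimality of [g] applies to it. *)
  have : ~~ (E < upto (d j)) by apply/negP => /gmin; rewrite leNgt jg.
  rewrite -leNgt; apply: le_trans; apply: ler_sum => l _.
  by case: (ltP (d l) g) => // lg; have -> : d l <= d j by exact: jmax.
exists g; first exact: d0.
rewrite leNgt; apply/negP => lt_D.
pose e : R := \sum_j (d j == g)%:R.
have uptoE : upto g = below g + e.
  rewrite -big_split; apply: eq_bigr => j _ /=.
  by case: (ltgtP (d j) g); rewrite ?addr0 ?add0r.
have e0 : 0 < e by move: Eg; rewrite -/g uptoE; lra.
pose S := \sum_j (d j < g)%R%:R * d j.
have minE : \sum_j Num.min (d j - g) 0 = S - below g * g.
  rewrite mulr_suml -sumrB; apply: eq_bigr => j _.
  case: (ltP (d j) g) => jg.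
    by rewrite !mul1r min_l// subr_le0 ltW.
  by rewrite !mul0r subr0 min_r// subr_ge0.
pose s := (E - below g) / e.
have s0 : 0 <= s by rewrite divr_ge0 ?subr_ge0// ltW.
have s1 : s < 1 by rewrite ltr_pdivrMr// mul1r; move: Eg; rewrite -/g uptoE; lra.
have g0 : 0 <= g by exact: d0.
pose sl := D - (S + (E - below g) * g).
have sl0 : 0 < sl by rewrite /sl; move: lt_D; rewrite minE; lra.
pose c := e * g + 1.
have c0 : 0 < c by rewrite /c ltr_wpDl// mulr_ge0// ltW.
(* The increase [h] of [s] keeps the fraction at most 1 and costs [h * e * g],
   less than the slack; the added 1 in [c] covers [g = 0]. *)
pose h := Num.min (1 - s) (sl / c).
have h0 : 0 < h by rewrite /h lt_min subr_gt0 s1 divr_gt0.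
have hs : h <= 1 - s by rewrite /h ge_min lexx.
have hc : h * c <= sl by rewrite -ler_pdivlMr// /h ge_min lexx orbT.
pose t j : R := (d j < g)%R%:R + (s + h) * (d j == g)%:R.
have tE : \sum_j t j = E + h * e.
  rewrite big_split/= -mulr_sumr -/(below g) -/e.
  have : s * e = E - below g by rewrite /s divfK// gt_eqF.
  lra.
have tdE : \sum_j t j * d j = S + (E - below g + h * e) * g.
  have -> : E - below g + h * e = (s + h) * e.
    have : s * e = E - below g by rewrite /s divfK// gt_eqF.
    lra.
  rewrite -mulrA mulr_suml mulr_sumr -big_split; apply: eq_bigr => j _ /=.
  by rewrite /t mulrDl -mulrA; case: eqVneq => [->|_]//; rewrite !mul0r.
suff : \sum_j t j <= E by rewrite tE; have := mulr_gt0 h0 e0; lra.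
apply: sol.
  move=> j; rewrite /t; case: (ltgtP (d j) g) => _ /=; lra.
by rewrite tdE; move: hc; rewrite /c /sl; lra.
Qed.

End knapsack.

(** * Worst-case probability of a set over the Wasserstein ball *)

(** The hypotheses on [d] say that it is the distance to [U]. Points of [U] only
    realize it approximately, as an open set need not contain a nearest point. *)
Section ball.
Context {R : realType} {I n N : nat}.
Local Notation M := 'M[R]_(I, n + 1).
Variable nrm : M -> R.
Hypothesis hnrm : is_norm nrm.
Variables (hN : (0 < N)%N) (zeta : 'I_N -> Xi R I n).
Variables (U : set (Xi R I n)) (d : M -> R).
Hypothesis mU : measurable U.
Hypothesis d_lower : forall u z : M, U u -> d z <= nrm (u - z).
Hypothesis d_upper : forall (z : M) (e : R), 0 < e ->
  exists2 u : M, U u & nrm (u - z) < d z + e.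

Lemma set_dist_ge0 z : 0 <= d z.
Proof.
rewrite leNgt; apply/negP => dz.
have [|u _] := @d_upper z (- d z); first by rewrite oppr_gt0.
by rewrite subrr ltNge is_norm_ge0.
Qed.

Lemma set_dist_lipschitz u v : d u <= d v + nrm (u - v).
Proof.
apply/ler_addgt0Pr => e e0; have [w Uw hw] := @d_upper v e e0.
have := is_norm_triangle hnrm w v u; have := @d_lower w u Uw.
by rewrite (is_normC hnrm v u); lra.
Qed.

Lemma integral_empirical (f : Xi R I n -> \bar R) :
  measurable_fun setT f -> (forall x, 0 <= f x)%E ->
  (\int[empirical hN zeta]_x f x = (N%:R^-1)%:E * \sum_j f (zeta j))%E.
Proof.
move=> mf f0.
have [||P [PE Pint]] := @finite_mixture _ (Xi R I n) R 'I_N (fun=> N%:R^-1) zeta.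
- by move=> _; rewrite invr_ge0.
- by rewrite sumr_const card_ord -[LHS]mulr_natr mulVf// pnatr_eq0 -lt0n.
rewrite ge0_sume_distrr; last by move=> j _.
rewrite -Pint//; apply: eq_measure_integral => A _ _.
by apply: (etrans _ (esym (PE A))); rewrite -ge0_sume_distrr.
Qed.

(** Integrate [g * 1_U u <= nrm (u - v) + max (g - d v) 0] against [Q]: for
    [u] in [U] it follows from [d v <= nrm (u - v)], and the last term only
    sees the second marginal, which is the empirical distribution. *)
Lemma transport_lower_bound (g : R) (P : probability (Xi R I n) R)
    (Q : probability (Xi R I n * Xi R I n)%type R) :
  0 <= g -> couplings P (empirical hN zeta) Q ->
  (g%:E * P U <= \int[Q]_z (nrm ((z.1 : M) - z.2))%:E +
    (N%:R^-1 * \sum_j Num.max (g - d (zeta j)) 0)%:E)%E.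
Proof.
move=> g0 cQ.
pose h (z : Xi R I n) : \bar R := (Num.max (g - d z) 0)%:E.
have mh : measurable_fun setT h.
  apply/measurable_EFinP; apply: (lipschitz_measurable hnrm) => u v.
  have := set_dist_lipschitz v u; rewrite (is_normC hnrm v u).
  have := is_norm_ge0 hnrm (u - v).
  have : g - d v <= Num.max (g - d v) 0 by rewrite le_max lexx.
  have : 0 <= Num.max (g - d v) 0 by rewrite le_max lexx orbT.
  by rewrite ge_max => *; apply/andP; split; lra.
have h0 z : (0 <= h z)%E by rewrite lee_fin le_max lexx orbT.
have hint : (\int[Q]_z h z.2 =
    (N%:R^-1 * \sum_j Num.max (g - d (zeta j)) 0)%:E)%E.
  have -> : (N%:R^-1 * \sum_j Num.max (g - d (zeta j)) 0)%:E =
      (\int[empirical hN zeta]_z h z)%E.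
    by rewrite integral_empirical// EFinM sumEFin.
  transitivity (\int[pushforward Q snd]_z h z)%E.
    by rewrite ge0_integral_pushforward// => z _; exact: h0.
  apply: eq_measure_integral => A mA _.
  apply: (etrans _ (cQ A mA).2); congr (Q _).
  by apply/seteqP; split => z //= [].
have indE : (g%:E * P U = \int[Q]_z (g%:E * (\1_(U `*` setT) z)%:E))%E.
  rewrite ge0_integralZl//; last first.
    by apply/measurable_EFinP; apply: measurable_indic; exact: measurableX.
  rewrite integral_indic//; last exact: measurableX.
  by rewrite setIT; congr (_ * _)%E; exact: (esym (cQ U mU).1).
have mc : measurable_fun setT
    (fun z : Xi R I n * Xi R I n => (nrm ((z.1 : M) - z.2))%:E).
  by apply/measurable_EFinP; exact: measurable_is_norm_sub.
rewrite -hint indE -ge0_integralD//; last 2 first.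
  by move=> z _; rewrite lee_fin is_norm_ge0.
  exact: (measurableT_comp mh measurable_snd).
apply: ge0_le_integral => //.
- by move=> z _; rewrite mule_ge0// lee_fin.
- apply: measurable_funeM; apply/measurable_EFinP; apply: measurable_indic.
  exact: measurableX.
- apply: emeasurable_funD => //.
  exact: (measurableT_comp mh measurable_snd).
move=> [u v] _ /=; rewrite -EFinM -EFinD lee_fin indicE.
have := is_norm_ge0 hnrm ((u : M) - v) => n0.
case: (boolP (_ \in _)) => [|_]; last first.
  by rewrite mulr0 addr_ge0// le_max lexx orbT.
rewrite inE /= => -[Uu _]; rewrite mulr1.
have := @d_lower u v Uu => duv.
have : g - d v <= Num.max (g - d v) 0 by rewrite le_max lexx.
lra.
Qed.

Lemma ambiguity_upper_bound (g delta : R) (P : probability (Xi R I n) R) :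
  0 <= g -> ambiguity nrm delta (empirical hN zeta) P ->
  (g%:E * P U <=
    (delta + N%:R^-1 * \sum_j Num.max (g - d (zeta j)) 0)%:E)%E.
Proof.
move=> g0 aP; rewrite EFinD -leeBlDr//; apply: le_trans aP.
apply/ereal_infP => _ [Q cQ <-].
by rewrite leeBlDr//; exact: transport_lower_bound.
Qed.

(** Split the atom at [zeta j] into a part [t j] moved to a point [u j] of [U]
    and a part [1 - t j] left in place. The joint law of the new and the old
    position is a coupling, and the slack [e] in the budget pays for
    [nrm (u j - zeta j)] exceeding [d (zeta j)]. *)
Lemma ambiguity_attains (delta : R) (t : 'I_N -> R) :
  (forall j, 0 <= t j <= 1) -> \sum_j t j * d (zeta j) < N%:R * delta ->
  exists2 P, ambiguity nrm delta (empirical hN zeta) P &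
    ((N%:R^-1 * \sum_j t j)%:E <= P U)%E.
Proof.
move=> t01 tD; have Npos : 0 < N%:R :> R by rewrite ltr0n.
pose e := delta - N%:R^-1 * \sum_j t j * d (zeta j).
have e0 : 0 < e by rewrite subr_gt0 mulrC ltr_pdivrMr// mulrC.
have /choice[u hu] : forall j : 'I_N, exists u : M,
    U u /\ nrm (u - zeta j) < d (zeta j) + e.
  by move=> j; have [u Uu hu] := @d_upper (zeta j) e e0; exists u.
pose w (k : 'I_N * bool) : R := N%:R^-1 * (if k.2 then t k.1 else 1 - t k.1).
pose p (k : 'I_N * bool) : Xi R I n * Xi R I n :=
  (if k.2 then u k.1 : Xi R I n else zeta k.1, zeta k.1).
have w0 k : 0 <= w k.
  rewrite mulr_ge0 ?invr_ge0//; have /andP[? ?] := t01 k.1.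
  by case: k.2 => //; rewrite subr_ge0.
(* Sums over the two parts of each atom, by atoms. *)
have sumw (F : 'I_N * bool -> R) : \sum_k w k * F k =
    N%:R^-1 * \sum_j (t j * F (j, true) + (1 - t j) * F (j, false)).
  rewrite mulr_sumr (eq_bigr (fun k => w (k.1, k.2) * F (k.1, k.2))); last by case.
  rewrite -(pair_bigA _ (fun j b => w (j, b) * F (j, b)))/=.
  apply: eq_bigr => j _; rewrite big_bool /w/=; ring.
have w1 : \sum_k w k = 1.
  transitivity (\sum_k w k * 1); first by apply: eq_bigr => k _; rewrite mulr1.
  rewrite sumw (eq_bigr (fun=> 1)); last by move=> j _; rewrite !mulr1 addrC subrK.
  by rewrite sumr_const card_ord mulVf// gt_eqF.
have [P [PE _]] := finite_mixture (fst \o p) w0 w1.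
have [Q [QE Qint]] := finite_mixture p w0 w1.
exists P.
  have cQ : couplings P (empirical hN zeta) Q.
    move=> A mA; split.
      rewrite QE PE; apply: eq_bigr => k _.
      by rewrite !diracE in_setX in_setT andbT.
    rewrite QE /empirical.
    rewrite (eq_bigr (fun k => (w k * (zeta k.1 \in A)%:R)%:E)); last first.
      move=> k _; by rewrite diracE in_setX in_setT EFinM.
    rewrite sumEFin sumw/= (eq_bigr (fun j => (zeta j \in A)%:R)); last first.
      by move=> j _; rewrite -mulrDl addrC subrK mul1r.
    by rewrite EFinM -sumEFin; congr (_ * _)%E; apply: eq_bigr => j _; rewrite diracE.
  apply: (@le_trans _ _ (\int[Q]_z (nrm ((z.1 : M) - z.2))%:E)%E).
    by apply: ereal_inf_lbound; exists Q.
  rewrite Qint; last 2 first.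
    by apply/measurable_EFinP; exact: measurable_is_norm_sub.
    by move=> z; rewrite lee_fin is_norm_ge0.
  rewrite (eq_bigr (fun k => (w k * nrm ((p k).1 - (p k).2 : M))%:E))//.
  rewrite sumEFin sumw/= lee_fin.
  have -> : delta = N%:R^-1 * \sum_j (t j * d (zeta j) + e).
    rewrite big_split/= sumr_const card_ord -[e *+ N]mulr_natr mulrDr.
    rewrite [_ * (e * _)]mulrCA mulVf ?gt_eqF//.
    by rewrite mulr1 /e addrC subrK.
  rewrite ler_pM2l ?invr_gt0//; apply: ler_sum => j _.
  have /andP[t0 t1] := t01 j; rewrite subrr is_norm0// mulr0 addr0.
  have [_ /ltW huj] := hu j.
  apply: (le_trans (ler_wpM2l t0 huj)); rewrite mulrDr lerD2l.
  by rewrite ler_piMl// ltW.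
rewrite PE (eq_bigr (fun k => (w k * ((p k).1 \in U)%:R)%:E)); last first.
  by move=> k _; rewrite diracE EFinM.
rewrite sumEFin sumw lee_fin ler_pM2l ?invr_gt0//; apply: ler_sum => j _ /=.
have /andP[t0 t1] := t01 j; rewrite mem_set ?mulr1; last by case: (hu j).
by rewrite lerDl mulr_ge0// subr_ge0.
Qed.

Theorem ambiguity_probability_le (eps delta : R) :
  0 < eps -> eps < 1 -> 0 < delta ->
  (forall P, ambiguity nrm delta (empirical hN zeta) P -> (P U <= eps%:E)%E) <->
  exists2 g, 0 <= g &
    delta - eps * g <= N%:R^-1 * \sum_j Num.min (d (zeta j) - g) 0.
Proof.
move=> eps0 eps1 delta0; have Npos : 0 < N%:R :> R by rewrite ltr0n.
split => [PU|[g g0 hg] P aP].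
  have [||||t t01 tD|g g0 hg] := @fractional_knapsack R N (d \o zeta)
    (N%:R * eps) (N%:R * delta).
  - exact: hN.
  - by move=> j; exact: set_dist_ge0.
  - by rewrite mulr_ge0// ltW.
  - by rewrite gtr_pMr.
  - have [P aP] := ambiguity_attains t01 tD.
    move=> /le_trans /(_ (PU P aP)); rewrite lee_fin.
    by rewrite mulrC ler_pdivrMr// mulrC.
  - exists g => //; rewrite [leRHS]mulrC ler_pdivlMr// [leLHS]mulrC; move: hg => /=.
    by rewrite mulrBr mulrA.
have minmax : \sum_j Num.min (d (zeta j) - g) 0 =
    - \sum_j Num.max (g - d (zeta j)) 0.
  by rewrite -sumrN; apply: eq_bigr => j _; rewrite oppr_max oppr0 opprB.
have gpos : 0 < g.
  rewrite lt0r g0 andbT; apply/eqP => g00; move: hg.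
  rewrite g00 mulr0 subr0 big1 ?mulr0; first by lra.
  by move=> j _; rewrite subr0 min_r// set_dist_ge0.
have := ambiguity_upper_bound g0 aP.
rewrite -[P U]fineK ?fin_num_measure// -EFinM !lee_fin => h.
rewrite -(ler_pM2l gpos); apply: (le_trans h).
by move: hg; rewrite minmax mulrN; lra.
Qed.

End ball.

(** * Dual norm and distance to a half-space *)

Section dual_norm.
Context {R : realType} {I m : nat}.
Variables (nrm : 'M[R]_(I, m) -> R) (dnrm : 'cV[R]_m -> R).
Hypotheses (hnrm : is_norm nrm) (hdnrm : is_dual_norm nrm dnrm).

(** Without this bound the supremum that defines the dual norm would be a
    default value. *)
Lemma dual_norm_has_ubound (i : 'I_I) (a : 'cV[R]_m) :
  has_ubound [set (u *m a) i 0 | u in [set u | nrm u <= 1]].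
Proof.
have [c c0 hc] := sup_le_is_norm hnrm.
exists (\sum_k c^-1 * `|a k 0|) => _ [u /= u1 <-].
rewrite mxE; apply: ler_sum => k _; apply: le_trans (ler_norm _) _.
rewrite normrM ler_wpM2r// -[leRHS]mulr1 ler_pdivlMl//.
exact: le_trans (hc u i k) u1.
Qed.

Lemma le_dual_norm (i : 'I_I) (a : 'cV[R]_m) (u : 'M[R]_(I, m)) :
  (u *m a) i 0 <= dnrm a * nrm u.
Proof.
case: (hnrm) => _ nZ n0; have [/n0 ->|u0] := eqVneq (nrm u) 0.
  by rewrite mul0mx mxE is_norm0// mulr0.
have u_gt0 : 0 < nrm u by rewrite lt0r u0 is_norm_ge0.
rewrite -ler_pdivrMr// (hdnrm i); apply: ub_le_sup.
  exact: dual_norm_has_ubound.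
exists ((nrm u)^-1 *: u); last by rewrite -scalemxAl mxE mulrC.
by rewrite /= nZ ger0_norm ?mulVf// invr_ge0 ltW.
Qed.

(** Test [le_dual_norm] on the matrix all of whose rows are [a]. *)
Lemma dual_norm_gt0 (i : 'I_I) (a : 'cV[R]_m) : a != 0 -> 0 < dnrm a.
Proof.
move=> a0; rewrite ltNge; apply/negP => da.
pose u : 'M[R]_(I, m) := \matrix_(_, k) a k 0.
have : (u *m a) i 0 <= 0.
  apply: le_trans (le_dual_norm i a u) _.
  by rewrite mulr_le0_ge0// is_norm_ge0.
rewrite mxE (eq_bigr (fun k => (a k 0) ^+ 2)); last by move=> k _; rewrite mxE.
move=> s0; have /eqP : \sum_k a k 0 ^+ 2 = 0.
  by apply/le_anti; rewrite s0 sumr_ge0// => k _; exact: sqr_ge0.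
rewrite psumr_eq0; last by move=> k _; exact: sqr_ge0.
move=> /allP az; move/eqP: a0; apply; apply/colP => k; rewrite mxE.
by apply/eqP; rewrite -sqrf_eq0; apply: az; rewrite mem_index_enum.
Qed.

Lemma dual_norm_approx (i : 'I_I) (a : 'cV[R]_m) (c : R) : c < dnrm a ->
  exists2 v, nrm v <= 1 & c < (v *m a) i 0.
Proof.
rewrite (hdnrm i) => /sup_gt[|_ [v v1 <-] cv]; last by exists v.
by exists ((0 *m a) i 0), 0 => //=; rewrite is_norm0.
Qed.

Lemma halfspace_dist_lower (i : 'I_I) (a : 'cV[R]_m) (b : R) (u z : 'M[R]_(I, m)) :
  a != 0 -> b < (u *m a) i 0 ->
  Num.max (b - (z *m a) i 0) 0 / dnrm a <= nrm (u - z).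
Proof.
move=> a0 bu; rewrite ler_pdivrMr; last exact: dual_norm_gt0.
rewrite mulrC ge_max mulr_ge0 ?andbT; first last.
- exact: is_norm_ge0.
- exact/ltW/dual_norm_gt0.
apply: le_trans (le_dual_norm i a (u - z)).
by rewrite mulmxBl !mxE lerD2r; move: bu; rewrite mxE => /ltW.
Qed.

(** Move from [z] by the length [s], the bound to be proved, in a direction that
    nearly attains the dual norm: [s * dnrm a] exceeds the violation [c] that
    has to be overcome, so a direction [v] with [c / s < (v *m a) i 0] does. *)
Lemma halfspace_dist_upper (i : 'I_I) (a : 'cV[R]_m) (b e : R) (z : 'M[R]_(I, m)) :
  a != 0 -> 0 < e -> exists2 u, b < (u *m a) i 0 &
    nrm (u - z) <= Num.max (b - (z *m a) i 0) 0 / dnrm a + e.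
Proof.
move=> a0 e0; have da := dual_norm_gt0 i a0.
set c := Num.max _ _.
have c0 : 0 <= c by rewrite le_max lexx orbT.
pose s := c / dnrm a + e.
have s0 : 0 < s by rewrite ltr_wpDl// divr_ge0// ltW.
have [|v v1 cv] := @dual_norm_approx i a (c / s).
  rewrite ltr_pdivrMr// mulrDr mulrCA divff ?gt_eqF// mulr1 ltrDl.
  exact: mulr_gt0.
exists (z + s *: v).
  have -> : ((z + s *: v) *m a) i 0 = (z *m a) i 0 + s * (v *m a) i 0.
    by rewrite mulmxDl -scalemxAl mxE [X in _ + X]mxE.
  move: cv; rewrite ltr_pdivrMr// => cv.
  have : b - (z *m a) i 0 <= c by rewrite le_max lexx.
  by rewrite [s * _]mulrC; lra.
case: hnrm => _ nZ _.
by rewrite addrC addKr nZ gtr0_norm// -[leRHS]mulr1 ler_pM2l.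
Qed.

End dual_norm.

(** * Safety set and the function f *)

Section safety.
Context {R : realType} {I n : nat}.
Local Notation M := 'M[R]_(I, n + 1).

Lemma measurable_linear_row (i : 'I_I) (a : 'cV[R]_(n + 1)) :
  measurable_fun setT (fun z : Xi R I n => ((z : M) *m a) i 0).
Proof.
rewrite (_ : (fun _ => _) = fun z : Xi R I n => \sum_k (z : M) i k * a k 0); last first.
  by apply/funext => z; rewrite mxE.
apply: measurable_sum => k; apply: measurable_funM => //.
apply: continuous_measurable_Xi; exact: coord_continuous.
Qed.

Lemma measurable_safety_set eta1 eta2 (B : 'I_I -> 'cV[R]_n) b x :
  measurable (safety_set eta1 eta2 B b x).
Proof.
rewrite (_ : safety_set _ _ _ _ _ = \bigcap_(i in [set: 'I_I])
  [set z : Xi R I n | ((z : M) *m avec eta1 eta2 x) i 0 <= bfun B b i x]); last first.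
  by apply/seteqP; split => z h i; [move=> _; exact: h|exact: (h i Logic.I)].
apply: fin_bigcap_measurable => // i _.
rewrite -[X in measurable X]setTI.
have := @measurable_linear_row i (avec eta1 eta2 x) measurableT _
  (@measurable_itv R `]-oo, bfun B b i x]).
by congr (measurable (_ `&` _)); apply/seteqP; split => z; rewrite /= in_itv.
Qed.

Lemma ZsetP eta1 eta2 (B : 'I_I -> 'cV[R]_n) b nrm (eps delta : R) P0 x :
  Zset eta1 eta2 B b nrm eps delta P0 x <->
  forall P, ambiguity nrm delta P0 P ->
    (P (~` safety_set eta1 eta2 B b x) <= eps%:E)%E.
Proof.
have mS := measurable_safety_set eta1 eta2 B b x.
have PE (P : probability (Xi R I n) R) : ((1 - eps)%:E <= P (safety_set eta1 eta2 B b x))%E =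
    (P (~` safety_set eta1 eta2 B b x) <= eps%:E)%E.
  rewrite probability_setC// -[P _]fineK ?fin_num_measure//.
  by rewrite -EFinB !lee_fin lerBlDr lerBlDl addrC.
split=> [/ereal_infP xZ P aP|xP].
  by rewrite -PE; apply: xZ; exists P.
by apply/ereal_infP => _ [P aP <-]; rewrite PE; exact: xP.
Qed.

Lemma fdist_nonzero eta1 eta2 (B : 'I_I -> 'cV[R]_n) b dnrm x :
  (0 < I)%N -> avec eta1 eta2 x != 0 -> 0 < dnrm (avec eta1 eta2 x) ->
  exists d : M -> R, forall z,
    [/\ fdist eta1 eta2 B b dnrm x z = (d z)%:E,
       forall i, d z <= Num.max (bfun B b i x - (z *m avec eta1 eta2 x) i 0) 0
                        / dnrm (avec eta1 eta2 x)
     & exists i, d z = Num.max (bfun B b i x - (z *m avec eta1 eta2 x) i 0) 0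
                        / dnrm (avec eta1 eta2 x)].
Proof.
move=> I0 a0 da; pose F i z : R :=
  Num.max (bfun B b i x - (z *m avec eta1 eta2 x) i 0) 0 / dnrm (avec eta1 eta2 x).
have fE z : fdist eta1 eta2 B b dnrm x z = \big[mine/+oo%E]_(i : 'I_I) (F i z)%:E.
  rewrite /fdist /Iset (negbTE a0) finset.setC0 big_set0 min_l ?leey//.
  by apply: eq_bigl => i; rewrite finset.in_setT.
suff /choice[d hd] : forall z, exists r : R,
    [/\ fdist eta1 eta2 B b dnrm x z = r%:E, forall i, r <= F i z
      & exists i, r = F i z] by exists d.
move=> z; have [i _ Ei] := @eq_bigmin _ _ _ (+oo%E : \bar R) (Ordinal I0) xpredT
  (fun i => (F i z)%:E) isT (fun i _ => leey _).
exists (F i z); split; [by rewrite fE Ei| |by exists i].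
by move=> j; rewrite -lee_fin -Ei; exact: bigmin_le_cond.
Qed.

Lemma fdist_zero eta1 eta2 (B : 'I_I -> 'cV[R]_n) b dnrm x z :
  avec eta1 eta2 x = 0 ->
  fdist eta1 eta2 B b dnrm x z =
    if `[< exists i, bfun B b i x < 0 >] then 0%E else +oo%E.
Proof.
move=> a0; rewrite /fdist /Iset a0 eqxx finset.setCT big_set0.
have chi0 i : (0 <= chi [set y | (bfun B b i y < 0)%R] x :> \bar R)%E.
  by rewrite /chi; case: ifP.
case: asboolP => [[i bi]|nb].
  apply/eqP; rewrite eq_le; apply/andP; split.
    rewrite ge_min; apply/orP; right.
    have <- : chi [set y | (bfun B b i y < 0)%R] x = 0%E :> \bar R.
      by rewrite /chi mem_set.
    by apply: bigmin_le_cond; rewrite finset.inE.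
  by rewrite le_min leey/=; apply/bigmin_geP.
rewrite big1_idem ?minxx// => i _; rewrite /chi memNset// => bi.
by apply: nb; exists i.
Qed.

End safety.

Section unsafe_distance.
Context {R : realType} {I n : nat}.
Local Notation M := 'M[R]_(I, n + 1).
Variables (eta1 eta2 : bool) (B : 'I_I -> 'cV[R]_n) (b : 'I_I -> R).
Variables (nrm : M -> R) (dnrm : 'cV[R]_(n + 1) -> R).
Hypotheses (hnrm : is_norm nrm) (hdnrm : is_dual_norm nrm dnrm).
Variable x : 'cV[R]_n.
Local Notation unsafe := (~` safety_set eta1 eta2 B b x).

Lemma unsafeP (z : Xi R I n) :
  unsafe z <-> exists i, bfun B b i x < ((z : M) *m avec eta1 eta2 x) i 0.
Proof.
split=> [/existsNP[i /negP]|[i hi] hz]; first by rewrite -ltNge; exists i.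
by have := hz i; rewrite leNgt hi.
Qed.

(** If [a(x) = 0], a violated constraint is violated everywhere, and [f] is
    identically 0. Otherwise a union of half-spaces is as far away as the
    closest of them. *)
Lemma fdist_unsafe_distance : (0 < I)%N -> unsafe !=set0 ->
  exists d : M -> R, [/\ forall z, fdist eta1 eta2 B b dnrm x z = (d z)%:E,
    forall u z : M, unsafe u -> d z <= nrm (u - z) &
    forall (z : M) (e : R), 0 < e ->
      exists2 u : M, unsafe u & nrm (u - z) < d z + e].
Proof.
move=> I0 [w /unsafeP[i0 hi0]].
have [a0|a0] := eqVneq (avec eta1 eta2 x) 0.
  have bi0 : bfun B b i0 x < 0 by move: hi0; rewrite a0 mulmx0 mxE.
  exists (fun=> 0); split.
  - by move=> z; rewrite fdist_zero//; case: asboolP => // -[]; exists i0.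
  - by move=> u z _; exact: is_norm_ge0.
  - move=> z e e0; exists z; last by rewrite subrr is_norm0// add0r.
    by apply/unsafeP; exists i0; rewrite a0 mulmx0 mxE.
have [d hd] := @fdist_nonzero R I n eta1 eta2 B b dnrm x I0 a0
  (dual_norm_gt0 hnrm hdnrm (Ordinal I0) a0).
exists d; split.
- by move=> z; have [] := hd z.
- move=> u z /unsafeP[i hi]; have [_ dle _] := hd z.
  by apply: le_trans (dle i) _; exact: halfspace_dist_lower.
- move=> z e e0; have [_ _ [i ->]] := hd z.
  have [|u ui hu] := @halfspace_dist_upper _ _ _ _ _ hnrm hdnrm i _
    (bfun B b i x) (e / 2) z a0; first by rewrite divr_gt0.
  exists u; first by apply/unsafeP; exists i.
  by apply: le_lt_trans hu _; rewrite ltrD2l; lra.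
Qed.

(** A nonzero [a(x)] makes every half-space nonempty, so safety everywhere
    forces [a(x) = 0] and nonnegative right-hand sides. *)
Lemma fdist_safe z : (0 < I)%N -> unsafe = set0 ->
  fdist eta1 eta2 B b dnrm x z = +oo%E.
Proof.
move=> I0 U0; have safe u i : (u *m avec eta1 eta2 x) i 0 <= bfun B b i x.
  rewrite leNgt; apply/negP => ui.
  have /unsafeP : exists i, bfun B b i x < (u *m avec eta1 eta2 x) i 0 by exists i.
  by rewrite U0.
have [a0|a0] := eqVneq (avec eta1 eta2 x) 0.
  rewrite fdist_zero//; case: asboolP => // -[i].
  by rewrite ltNge; have := safe 0 i; rewrite mul0mx mxE => ->.
have [u ui _] := @halfspace_dist_upper _ _ _ _ _ hnrm hdnrm (Ordinal I0) _
  (bfun B b (Ordinal I0) x) 1 0 a0 ltr01.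
by move: ui; rewrite ltNge safe.
Qed.

End unsafe_distance.

(** * The reformulation *)

Theorem theorem1 (R : realType) (n I N : nat)
    (hn : (0 < n)%N) (hI : (0 < I)%N) (hN : (0 < N)%N)
    (eps delta : R) (heps0 : 0 < eps) (heps1 : eps < 1) (hdelta : 0 < delta)
    (eta1 eta2 : bool) (heta : (1 <= eta1 + eta2)%N)
    (B : 'I_I -> 'cV[R]_n) (b : 'I_I -> R)
    (nrm : 'M[R]_(I, n + 1) -> R) (hnrm : is_norm nrm)
    (dnrm : 'cV[R]_(n + 1) -> R) (hdnrm : is_dual_norm nrm dnrm)
    (zeta : 'I_N -> Xi R I n) :
  Zset eta1 eta2 B b nrm eps delta (empirical hN zeta) =
  [set x | exists gamma : R, 0 <= gamma /\
     ((delta - eps * gamma)%:E <=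
      (N%:R^-1)%:E *
      \sum_(j < N) mine (fdist eta1 eta2 B b dnrm x (zeta j) - gamma%:E) 0)%E].
Proof.
apply/funext => x; apply/propext; rewrite ZsetP /=.
have [U0|/set0P Une] := eqVneq (~` safety_set eta1 eta2 B b x) set0.
  split=> [_|_ P _]; last by rewrite U0 measure0 lee_fin ltW.
  exists (delta / eps); split; first by rewrite divr_ge0// ltW.
  rewrite big1; last by move=> j _; rewrite (fdist_safe hnrm hdnrm)// min_r.
  by rewrite mule0 mulrC divfK ?gt_eqF// subrr.
have [d [fE dlo dup]] :=
  @fdist_unsafe_distance _ _ _ eta1 eta2 B b _ dnrm hnrm hdnrm x hI Une.
have mU : measurable (~` safety_set eta1 eta2 B b x).
  by apply: measurableC; exact: measurable_safety_set.
have sumE g : ((N%:R^-1)%:E * \sum_(j < N)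
    mine (fdist eta1 eta2 B b dnrm x (zeta j) - g%:E) 0 =
    (N%:R^-1 * \sum_j Num.min (d (zeta j) - g) 0)%:E)%E.
  rewrite EFinM -sumEFin; congr (_ * _)%E; apply: eq_bigr => j _.
  by rewrite fE -EFinB -EFin_min.
rewrite (ambiguity_probability_le hnrm hN zeta mU dlo dup heps0 heps1 hdelta).
split=> [[g g0 hg]|[g [g0 hg]]]; exists g => //.
  by split=> //; rewrite sumE lee_fin.
by move: hg; rewrite sumE lee_fin.
Qed.
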